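(* Let $H$ be an $n$-vertex graph and let $G$ be a graph obtained from $H$ by subdividing each edge of $H$ at least $2\log_2 n$ times (i.e., replacing each edge by a path with at least $2\log_2 n$ internal vertices). Then $tww(G)\leqslant 4$.
   Context: A trigraph $G$ consists of a vertex set $V(G)$ and two disjoint sets of unordered pairs of distinct vertices: black edges $E(G)$ and red edges $R(G)$; a graph is a trigraph with no red edge. The red degree of a vertex is the number of red edges incident to it. Contracting two distinct vertices $u,v$ of a trigraph replaces them by a single new vertex $w$ such that, for every other vertex $z$, $wz$ is a black edge if $uz$ and $vz$ are both black edges, $wz$ is a non-edge if $uz$ and $vz$ are both non-edges, and $wz$ is a red edge otherwise; the rest of the trigraph is unchanged. A contraction sequence from an $n$-vertex trigraph $G$ is a sequence $G=G_n,\dots,G_1$ in which each $G_{j}$ is obtained from $G_{j+1}$ by one contraction. A $d$-sequence is a contraction sequence in which every trigraph has maximum red degree at most $d$. The twin-width $tww(G)$ is the least $d$ such that $G$ admits a $d$-sequence. *)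

(* Defs.v *)
From mathcomp Require Import all_boot.
Set Implicit Arguments. Unset Strict Implicit. Unset Printing Implicit Defensive.

(* A trigraph whose vertices are labelled by elements of a finite type T:
   vertex set tV, black edges tblack, red edges tred (as relations;
   wellformed trigraphs have them symmetric, irreflexive, disjoint and
   supported on tV). *)
Record trigraph (T : finType) := Trigraph {
  tV : {set T};
  tblack : rel T;
  tred : rel T }.

Section Trigraphs.
Variable T : finType.
Implicit Types (t : trigraph T) (u v x y : T).

Definition nonedge t x y := ~~ tblack t x y && ~~ tred t x y.

(* Contraction of u and v: the new vertex w is given the label u (the old u
   and v are removed). For z <> w: wz black iff uz, vz black; wz non-edge iff
   uz, vz non-edges; red otherwise. The rest is unchanged. *)
Definition contract t u v : trigraph T :=
  let V' := tV t :\ v in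
  Trigraph V'
    (fun x y => [&& x \in V', y \in V', x != y &
       if x == u then tblack t u y && tblack t v y
       else if y == u then tblack t x u && tblack t x v
       else tblack t x y])
    (fun x y => [&& x \in V', y \in V', x != y &
       if x == u then ~~ (tblack t u y && tblack t v y) &&
                      ~~ (nonedge t u y && nonedge t v y)
       else if y == u then ~~ (tblack t x u && tblack t x v) &&
                           ~~ (nonedge t x u && nonedge t x v)
       else tred t x y]).

Definition red_degree t x := #|[set y in tV t | tred t x y]|.

Definition max_red_deg_le t d := [forall x in tV t, red_degree t x <= d].

Fixpoint dseq d t (s : seq (T * T)) : bool :=
  max_red_deg_le t d &&
  match s with
  | [::] => #|tV t| <= 1
  | (u, v) :: s' => [&& u != v, u \in tV t, v \in tV t & dseq d (contract t u v) s']
  end.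

Definition graph_trigraph (g : rel T) : trigraph T :=
  Trigraph [set: T] g (fun _ _ => false).

Definition tww_le (g : rel T) (d : nat) : Prop :=
  exists s : seq (T * T), dseq d (graph_trigraph g) s.

End Trigraphs.

Definition simple_graph n (e : rel 'I_n) : Prop :=
  symmetric e /\ irreflexive e.

(* [is_subdivision e g ok]: the graph (T, g) is obtained from the graph
   ('I_n, e) by replacing each edge ab (a < b) by a path
   phi a, P a b, phi b, whose sequence of internal vertices P a b satisfies
   ok (size (P a b)). *)
Definition is_subdivision n (e : rel 'I_n) (T : finType) (g : rel T)
    (ok : nat -> bool) : Prop :=
  exists (phi : 'I_n -> T) (P : 'I_n -> 'I_n -> seq T),
  [/\ injective phi,
      (forall a b : 'I_n, a < b -> e a b ->
         [/\ ok (size (P a b)), uniq (P a b) &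
             forall x, x \in P a b ->
               (forall c, x != phi c) /\
               (forall a' b' : 'I_n, a' < b' -> e a' b' -> x \in P a' b' ->
                  a' = a /\ b' = b)]),
      (forall x : T, (exists c, x = phi c) \/
                     (exists a b : 'I_n, [/\ a < b, e a b & x \in P a b])) &
      (forall x y : T, g x y <->
         exists a b : 'I_n, [/\ a < b, e a b &
           exists s1 s2, phi a :: P a b ++ [:: phi b] = s1 ++ x :: y :: s2 \/
                         phi a :: P a b ++ [:: phi b] = s1 ++ y :: x :: s2])].

(* Main.v *)
Require Import Defs.
From mathcomp Require Import all_boot zify.
Set Implicit Arguments. Unset Strict Implicit. Unset Printing Implicit Defensive.

(** A contraction sequence is a chain of coarser and coarser partitions of the
vertex set. If a partition refines another one and every part of the coarser
one sends edges to at most four parts of the finer one, then one can go from the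
finer to the coarser by pairwise merges in an arbitrary order, without ever
exceeding red degree four; edges between completely joined parts can be ignored.

First all the subdivided edges are shortened to a common length [M] (with
[n <= 2 ^ (M / 2)]) by contracting inside each path. Then the vertex on level
[l] of the path from [a] to [b] is put at time [sg] in the part
[(l, a / 2 ^ ((l + sg - M) / 2), b / 2 ^ ((sg - l) / 2))]. At each tick the new
shift of [a] on level [l] is the old one of level [l + 1], and exceeds that of
level [l - 1] by at most one; symmetrically for [b]. Hence each part meets at
most two parts on each adjacent level. Up to time [M] the branching vertices are
untouched and have only black edges; from time [M] on, their part is consistent
between levels [0] and [M], and at time [2 M] only the level is left. The
resulting cycle of length [M] is finally folded. *)

(** * Contraction sequences as coarsening partitions *)

Section Quotients.
Variables (T : finType) (g : rel T).
Implicit Types (t : trigraph T) (lab : T -> T) (r : rel T).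

Definition all_pairs r (A B : {set T}) := [forall x in A, forall y in B, r x y].

Definition fibre lab p : {set T} := [set x | lab x == p].

(** A vertex of [t] is the label of the part contracted into it. The last clause keeps the diagonal,
    on which the other clauses are silent, out of the red degree. *)
Definition represents t lab : Prop :=
  [/\ tV t =i codom lab,
      {in tV t &, forall p q, p != q ->
         tblack t p q = all_pairs g (fibre lab p) (fibre lab q)},
      {in tV t &, forall p q, p != q ->
         tred t p q = ~~ all_pairs g (fibre lab p) (fibre lab q) &&
           ~~ all_pairs (fun x y => ~~ g x y) (fibre lab p) (fibre lab q)} &
      forall p, tred t p p = false].

Lemma all_pairsP r (A B : {set T}) :
  reflect {in A & B, forall x y, r x y} (all_pairs r A B).
Proof.
apply: (iffP forall_inP) => [H x y xA yB|H x xA]; first by move/forall_inP: (H x xA); apply.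
by apply/forall_inP => y yB; apply: H.
Qed.

Lemma all_pairsUl r (A A' B : {set T}) :
  all_pairs r (A :|: A') B = all_pairs r A B && all_pairs r A' B.
Proof.
apply/all_pairsP/andP => [H|[/all_pairsP H /all_pairsP H'] x y].
  by split; apply/all_pairsP => x y xA yB; apply: H => //; rewrite inE xA ?orbT.
by rewrite inE => /orP[]; [apply: H | apply: H'].
Qed.

Lemma all_pairsUr r (A B B' : {set T}) :
  all_pairs r A (B :|: B') = all_pairs r A B && all_pairs r A B'.
Proof.
apply/all_pairsP/andP => [H|[/all_pairsP H /all_pairsP H'] x y xA].
  by split; apply/all_pairsP => x y xA yB; apply: H => //; rewrite inE yB ?orbT.
by rewrite inE => /orP[]; [apply: H | apply: H'].
Qed.

Definition merge_label lab u v : T -> T := fun x => if lab x == v then u else lab x.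

Lemma fibre_merge lab u v p : p != v ->
  fibre (merge_label lab u v) p =
    if p == u then fibre lab u :|: fibre lab v else fibre lab p.
Proof.
move=> pv; apply/setP => x; rewrite inE /merge_label.
by case: (eqVneq p u) => [->|pu]; case: (eqVneq (lab x) v) => xv;
  rewrite !inE ?xv ?eqxx ?orbT ?orbF //
    1?eq_sym ?(negbTE pu) 1?eq_sym ?(negbTE pv) // (negbTE xv) orbF.
Qed.

Lemma fibre_nonempty t lab p : represents t lab -> p \in tV t -> exists x, lab x = p.
Proof. by case=> tVE _ _ _; rewrite tVE => /codomP[x ->]; exists x. Qed.

(** Parts are nonempty, so being completely joined and being completely unjoined exclude each
    other. *)
Lemma nonedge_represents t lab : represents t lab ->
  {in tV t &, forall p q, p != q ->
    nonedge t p q = all_pairs (fun x y => ~~ g x y) (fibre lab p) (fibre lab q)}.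
Proof.
move=> R p q pV qV pq; have [_ bE rE _] := R.
rewrite /nonedge bE // rE //.
have [x xp] := fibre_nonempty R pV; have [y yq] := fibre_nonempty R qV.
have xf : x \in fibre lab p by rewrite inE xp.
have yf : y \in fibre lab q by rewrite inE yq.
case: all_pairsP => [H|_] /=; last by rewrite negbK.
by case: all_pairsP => [H'|//]; case/negP: (H' x y xf yf); apply: H.
Qed.

Lemma represents_contract t lab u v : represents t lab ->
  u != v -> u \in tV t -> v \in tV t ->
  represents (contract t u v) (merge_label lab u v).
Proof.
move=> R uv uV vV; have [VE bE rE rxx] := R; have nE := nonedge_represents R.
split.
- move=> p; rewrite /= !inE VE; apply/andP/codomP => [[pv /codomP[x pE]]|[x ->]].
    by exists x; rewrite /merge_label -pE (negbTE pv).
  rewrite /merge_label; case: ifP => [_|/negbT ->]; last by rewrite codom_f.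
  by rewrite uv -VE.
- move=> p q; rewrite /= => pV' qV' pq; rewrite pV' qV' pq /=.
  move: pV' qV'; rewrite !inE => /andP[pv pV] /andP[qv qV].
  rewrite !fibre_merge //.
  case: (eqVneq p u) pq => [-> uq|pu pq].
    by rewrite eq_sym (negbTE uq) all_pairsUl !bE // eq_sym.
  by case: (eqVneq q u) pq => [-> _|qu pq]; rewrite ?all_pairsUr !bE.
- move=> p q; rewrite /= => pV' qV' pq; rewrite pV' qV' pq /= -!/(nonedge _ _ _).
  move: pV' qV'; rewrite !inE => /andP[pv pV] /andP[qv qV].
  rewrite !fibre_merge //.
  case: (eqVneq p u) pq => [-> uq|pu pq].
    have vq : v != q by rewrite eq_sym.
    by rewrite eq_sym (negbTE uq) !all_pairsUl !bE // !nE.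
  by case: (eqVneq q u) pq => [-> _|qu pq]; rewrite ?all_pairsUr ?bE ?nE ?rE.
- by move=> p; rewrite /= eqxx !andbF.
Qed.

Lemma represents_graph : represents (graph_trigraph g) id.
Proof.
have fE p : fibre id p = [set p] by apply/setP => x; rewrite !inE.
have aE r p q : all_pairs r [set p] [set q] = r p q.
  apply/all_pairsP/idP => [|H x y]; first by apply; rewrite inE.
  by rewrite !inE => /eqP-> /eqP->.
split=> //= [p|p q _ _ _|p q _ _ _]; rewrite ?fE ?aE ?negbK ?andNb //.
by rewrite inE; apply/esym/codomP; exists p.
Qed.

Definition same_kernel (K : eqType) lab (f : T -> K) :=
  forall x y, (lab x == lab y) = (f x == f y).

(** The labels depend on the contractions made so far, so every trigraph representing the partition
    is allowed as a starting point. *)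
Definition solvable d (K : eqType) (f : T -> K) :=
  forall t lab, represents t lab -> same_kernel lab f -> exists s, dseq d t s.

(* [r] contains every edge of [g] between parts of [f] that are not completely
   joined; only those edges can turn red before the partition is coarser than [f]. *)
Definition covers_red r (K : eqType) (f : T -> K) :=
  forall x y z w, f x = f z -> f y = f w -> g x y -> r x y || g z w.

(** This lets [covers_red] be checked once, for the coarsest partition of a phase. *)
Lemma covers_red_refine r (K K' : eqType) (f : T -> K) (f' : T -> K') :
  (forall x y, f x = f y -> f' x = f' y) -> covers_red r f' -> covers_red r f.
Proof. by move=> ff' H x y z w /ff' ? /ff' ? ?; apply: H. Qed.

Lemma tww_le_solvable d (K : eqType) (f : T -> K) :
  injective f -> solvable d f -> tww_le g d.
Proof.
move=> inj_f sf; apply: (sf _ id represents_graph) => x y.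
by rewrite (inj_eq inj_f).
Qed.

Lemma solvable_kernel d (K K' : eqType) (f : T -> K) (f' : T -> K') :
  (forall x y, (f x == f y) = (f' x == f' y)) -> solvable d f -> solvable d f'.
Proof. by move=> ff' sf t lab R k; apply: (sf t lab) => // x y; rewrite ff' k. Qed.

Lemma solvable_const d (K : eqType) (f : T -> K) :
  0 < d -> (forall x y, f x = f y) -> solvable d f.
Proof.
move=> d0 fc t lab R k; exists [::]; have [VE _ _ _] := R.
have V1 : #|tV t| <= 1.
  apply/card_le1_eqP => p q; rewrite !VE => /codomP[x ->] /codomP[y ->].
  by apply/eqP; rewrite k (fc x y).
rewrite /= V1 andbT; apply/forall_inP => p _; apply: leq_trans d0.
by apply: leq_trans V1; apply/subset_leq_card/subsetP => q; rewrite inE => /andP[].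
Qed.

(** Every partition between [f] and [f'] has small red degree: a part lies inside one part of [f'],
    and each of its red neighbours contains a part of [f] listed in [s], distinct neighbours
    containing distinct ones. So parts can be merged in any order until [f'] is reached. *)
Lemma solvable_refine d r (K K' : eqType) (f : T -> K) (f' : T -> K') :
    (forall x y, f x = f y -> f' x = f' y) ->
    covers_red r f' ->
    (forall x0, exists2 s : seq K, size s <= d &
       forall x y, f' x = f' x0 -> r x y -> f x != f y -> f y \in s) ->
  solvable d f' -> solvable d f.
Proof.
move=> ff' cov deg sf' t lab R k.
have lf' x y : lab x = lab y -> f' x = f' y by move/eqP; rewrite k => /eqP/ff'.
have {k} fl x y : f x = f y -> lab x = lab y by move/eqP; rewrite -k => /eqP.
have [m] := ubnP #|codom lab|; elim: m => // m IH in t lab R fl lf' *.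
rewrite ltnS => labm; have [VE bE rE rxx] := R.
have Vlab x : lab x \in tV t by rewrite VE codom_f.
have t_deg : max_red_deg_le t d.
  apply/forall_inP => p; rewrite VE => /codomP[x0 ->].
  have [s sd sP] := deg x0; apply: leq_trans sd.
  (* [h] maps a part of [f] to the current part containing it; [lab x0] is a dummy for values that
     [f] does not take. *)
  pose h z := if [pick y | f y == z] is Some y then lab y else lab x0.
  rewrite -(size_map h); apply: leq_trans (card_size _).
  apply/subset_leq_card/subsetP => q; rewrite inE VE => /andP[/codomP[y0 ->]].
  have [->|xy] := eqVneq (lab y0) (lab x0); first by rewrite rxx.
  rewrite rE // 1?eq_sym // => /andP[/all_pairsP nE /all_pairsP nN].
  (* Without an [r]-edge between the two parts, [cov] would spread a single edge to all pairs, and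
     the parts would be completely joined. *)
  have /existsP[x /existsP[y /and3P[/eqP xx0 /eqP yy0 rxy]]] :
      [exists x, exists y, [&& lab x == lab x0, lab y == lab y0 & r x y]].
    apply: contraT => /existsPn nr; case: nE => x y; rewrite !inE => /eqP xx0 /eqP yy0.
    apply: contraT => ngxy; case: nN => z w.
    rewrite !inE => /eqP zx0 /eqP wy0; apply/negP => gzw.
    have := cov z w x y (lf' _ _ (etrans zx0 (esym xx0)))
      (lf' _ _ (etrans wy0 (esym yy0))) gzw.
    rewrite (negbTE ngxy) orbF => rzw; have /existsPn/(_ w) := nr z.
    by rewrite zx0 wy0 !eqxx rzw.
  have fxy : f x != f y.
    by apply: contraNneq xy => /fl; rewrite xx0 yy0 => ->.
  apply/mapP; exists (f y); first exact: sP (lf' _ _ xx0) rxy fxy.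
  rewrite /h; case: pickP => [y' /eqP/fl ->//|/(_ y)]; by rewrite eqxx.
have [/existsP[x /existsP[y /andP[/eqP fxy lxy]]]|same] :=
  boolP [exists x, exists y, (f' x == f' y) && (lab x != lab y)].
  have R' := represents_contract R lxy (Vlab x) (Vlab y).
  case: (IH _ _ R') => [a b /fl ab|a b|//|s sP].
  - by rewrite /merge_label ab.
  - rewrite /merge_label; case: eqP => [/lf' ay|_]; case: eqP => [/lf' bY|_].
    + by rewrite ay bY.
    + by move/lf'; rewrite ay -fxy.
    + by move/lf' => ->; rewrite bY.
    + exact: lf'.
  - apply: leq_trans labm; apply: proper_card; apply/properP; split.
      apply/subsetP => p /codomP[z ->]; rewrite /merge_label.
      by case: ifP => _; apply: codom_f.
    exists (lab y); first exact: codom_f.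
    apply/codomP => -[z]; rewrite /merge_label; case: eqP => [_ /eqP|nz /esym //].
    by rewrite eq_sym (negbTE lxy).
  by exists ((lab x, lab y) :: s); rewrite /= t_deg lxy !Vlab.
apply: (sf' _ _ R) => x y; apply/eqP/eqP => [/lf' //|/eqP fxy].
move: same; rewrite negb_exists => /forallP/(_ x); rewrite negb_exists.
by move/forallP/(_ y); rewrite fxy /= negbK => /eqP.
Qed.

End Quotients.

(** * Arithmetic of binary prefixes and of shortened paths *)

Lemma leq_divn_exp2 c c' a b : c <= c' -> a %/ 2 ^ c = b %/ 2 ^ c -> a %/ 2 ^ c' = b %/ 2 ^ c'.
Proof. by move=> cc' ab; rewrite -(subnKC cc') expnD !divnMA ab. Qed.

(** At most one bit [i] is unknown, and it matters only if [s' = s.+1]; the factor 2 gives one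
    formula for all cases. *)
Lemma divn_exp2_shift s s' b : s' <= s.+1 ->
  exists2 i, i < 2 & b %/ 2 ^ s = (2 * (b %/ 2 ^ s') + i) %/ 2 ^ (s.+1 - s').
Proof.
rewrite leq_eqVlt => /predU1P[->|ss'].
  exists (b %/ 2 ^ s %% 2); first by rewrite ltn_mod.
  by rewrite subnn divn1 expnSr divnMA mulnC -divn_eq.
exists 0 => //; rewrite addn0 subSn // expnS divnMl //.
by rewrite -divnMA -expnD subnKC.
Qed.

Lemma divn_exp2_small n k b : b < n -> n <= 2 ^ k -> b %/ 2 ^ k = 0.
Proof. by move=> bn nk; rewrite divn_small // (leq_trans bn). Qed.

(** The identity up to 2, then constant for [p] steps, then a shift by [p]. Stopping at 2 leaves
    position 1 alone and, for common length at least 4, also the last inner position. *)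
Definition plateau p j := maxn (minn j 2) (j - p).

Lemma plateauE p j : plateau p j = if j <= 2 then j else maxn 2 (j - p).
Proof. by rewrite /plateau; case: leqP => // _; apply/maxn_idPl/leq_subr. Qed.

Lemma plateauD p q j : plateau (p + q) j = plateau q (plateau p j).
Proof.
rewrite (plateauE p) (plateauE (p + q)); case: (leqP j 2) => j2.
  by rewrite plateauE j2.
rewrite plateauE subnDA; case: (leqP (j - p) 2) => jp /=.
  by apply/maxn_idPl; apply: leq_trans (leq_subr _ _) jp.
by rewrite leqNgt jp.
Qed.

Lemma plateau0 j : plateau 0 j = j.
Proof. by rewrite /plateau subn0; apply/maxn_idPr; apply: geq_minl. Qed.

Lemma plateau_step p j : plateau p j.+1 = plateau p j \/ plateau p j.+1 = (plateau p j).+1.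
Proof. by rewrite !plateauE; case: (leqP j 2) => j2; case: (leqP j.+1 2) => j3; lia. Qed.

Lemma plateau1_bounds j : plateau 1 j <= j <= (plateau 1 j).+1.
Proof. by rewrite plateauE; case: (leqP j 2) => j2; lia. Qed.

Lemma plateau_eq0 p j : (plateau p j == 0) = (j == 0).
Proof. by rewrite plateauE; case: ifP => // j2; rewrite !eqn0Ngt; lia. Qed.

(** * The contraction sequence of a subdivision given by addresses *)

Section Subdivision.
Variables (n : nat) (E : rel 'I_n) (T : finType) (g : rel T).
Variables (m : 'I_n -> 'I_n -> nat) (adr : T -> nat * 'I_n * 'I_n).

(* A branching vertex [c] has address [(0, c, c)], the vertex at position [j > 0]
   inside the path from [a] to [b] has address [(j, a, b)]. *)
Definition path_adr a b j : nat * 'I_n * 'I_n :=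
  if j == 0 then (0, a, a) else if j == (m a b).+1 then (0, b, b) else (j, a, b).

Hypothesis adr_inj : injective adr.
Hypothesis adr_valid : forall x, let: (j, a, b) := adr x in
  if j == 0 then a = b else j <= m a b /\ E a b.
Hypothesis adr_edge : forall x y, g x y -> exists a b j,
  [/\ E a b, j <= m a b &
      (adr x = path_adr a b j /\ adr y = path_adr a b j.+1) \/
      (adr y = path_adr a b j /\ adr x = path_adr a b j.+1)].
Hypothesis edge_adr : forall a b j x y, E a b -> j <= m a b ->
  adr x = path_adr a b j -> adr y = path_adr a b j.+1 -> g x y && g y x.

Variable M : nat.
Hypothesis m_gt0 : forall a b, E a b -> 0 < m a b.
Hypothesis M_small : forall a b, E a b -> (m a b).+1 = M \/ 4 <= M <= (m a b).+1.
Hypothesis n_small : n <= 2 ^ (M %/ 2).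

Variable D : nat.
Hypothesis m_leD : forall a b, m a b <= D.

(* The position [j] on the path from [a] to [b], where up to [t] of the positions
   exceeding the common length [M] are identified with position 2. For [t = D]
   the end [b] is on level [M]. *)
Definition level t a b j := plateau (minn t ((m a b).+1 - M)) j.

(* The part of a vertex: the level together with prefixes of the binary
   expansions of both ends, [c l] and [s l] being the numbers of bits dropped. *)
Definition code t (c s : nat -> nat) x : nat * nat * nat :=
  let: (j, a, b) := adr x in
  if j == 0 then (0, a %/ 2 ^ c 0, 0)
  else let l := level t a b j in (l, a %/ 2 ^ c l, b %/ 2 ^ s l).

Definition is_root x := (adr x).1.1 == 0.

Definition inner x y := [&& g x y, ~~ is_root x & ~~ is_root y].

Lemma level_eq0 t a b j : (level t a b j == 0) = (j == 0).
Proof. exact: plateau_eq0. Qed.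

Lemma levelS t a b j :
  level t a b j.+1 = level t a b j \/ level t a b j.+1 = (level t a b j).+1.
Proof. exact: plateau_step. Qed.

Lemma level_split t d a b :
  exists p, level (t + d) a b =1 plateau p \o level t a b /\ p <= d.
Proof.
set ex := (m a b).+1 - M; exists (minn (t + d) ex - minn t ex); split; last first.
  by rewrite leq_subLR; case: (leqP t ex) => h; [rewrite geq_minl|lia].
have min_le : minn t ex <= minn (t + d) ex.
  by rewrite leq_min geq_minr andbT (leq_trans (geq_minl _ _)) ?leq_addr.
by move=> j; rewrite /level /= -plateauD subnKC.
Qed.

Lemma code_eq_root t c s x y : code t c s x = code t c s y -> is_root x = is_root y.
Proof.
rewrite /code /is_root; case: (adr x) => -[i a] b; case: (adr y) => -[j a'] b' /=.
case: (i =P 0) => i0; case: (j =P 0) => j0 //= -[] /eqP; rewrite 1?[0 == _]eq_sym;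
  by rewrite level_eq0 => /eqP.
Qed.

Lemma code_refine c s c' s' x y :
    (forall l, c l <= c' l) -> (forall l, s l <= s' l) ->
  code D c s x = code D c s y -> code D c' s' x = code D c' s' y.
Proof.
move=> cc' ss' H; have := code_eq_root H; move: H; rewrite /code /is_root.
case: (adr x) => -[i a] b; case: (adr y) => -[j a'] b' /=.
case: eqP => [_|_]; case: eqP => //= _; first by case=> /(leq_divn_exp2 (cc' _)) ->.
case=> lE + + _; rewrite lE.
by move=> /(leq_divn_exp2 (cc' _)) -> /(leq_divn_exp2 (ss' _)) ->.
Qed.

Definition zero (l : nat) := 0.

Lemma clip_refine t t' x y : t <= t' ->
  code t zero zero x = code t zero zero y -> code t' zero zero x = code t' zero zero y.
Proof.
move=> tt' H; have := code_eq_root H; move: H; rewrite /code /is_root /zero.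
case: (adr x) => -[i a] b; case: (adr y) => -[j a'] b' /=.
case: eqP => [_|_]; case: eqP => //= _ [].
rewrite !divn1 => lE /val_inj ? /val_inj ?; subst a' b' => _.
have [p [lp _]] := level_split t (t' - t) a b.
by congr (_, _, _); move: (lp i) (lp j); rewrite subnKC //= lE => -> ->.
Qed.

Lemma clip0_inj : injective (code 0 zero zero).
Proof.
move=> x y H; apply: adr_inj; have := code_eq_root H; move: H; rewrite /code /is_root /zero.
have := adr_valid x; have := adr_valid y.
case: (adr x) => -[i a] b; case: (adr y) => -[j a'] b' /=.
case: eqP => i0; case: eqP => j0 //=.
  by move=> <- <-; rewrite !divn1 i0 j0 => -[/val_inj ->].
rewrite !divn1 => _ _ [lE /val_inj -> /val_inj ->] _.
by move: lE; rewrite /level !min0n !plateau0 => ->.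
Qed.

Lemma levelD a b j : E a b ->
  level D a b j = maxn (minn j 2) (j - ((m a b).+1 - M)).
Proof.
move=> ab; have := m_leD a b; have := m_gt0 ab; have := M_small ab => *.
by rewrite /level /plateau; have /minn_idPr-> : (m a b).+1 - M <= D by lia.
Qed.

Lemma inner_edge x y : inner x y -> exists a b i j,
  [/\ E a b, 0 < i <= m a b, 0 < j <= m a b, i = j.+1 \/ j = i.+1 &
      adr x = (i, a, b) /\ adr y = (j, a, b)].
Proof.
case/and3P => /adr_edge[a [b [j [ab jm xy]]]] rx ry; exists a, b.
have [j0 jm' e1 e2] : [/\ 0 < j, j < m a b, path_adr a b j = (j, a, b) &
    path_adr a b j.+1 = (j.+1, a, b)].
  have mE := m_gt0 ab; have j1 : j.+1 == 0 = false by [].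
  have : ~~ ((path_adr a b j).1.1 == 0) && ~~ ((path_adr a b j.+1).1.1 == 0).
    by move: rx ry; rewrite /is_root; case: xy => -[-> ->] -> ->.
  rewrite /path_adr j1 eqSS; case: (j =P 0) => //= j0.
  case: (j =P (m a b).+1) => jm1; first by lia.
  by case: (j =P m a b) => jm2; rewrite ?andbF //= => _; split=> //; lia.
case: xy; rewrite e1 e2 => -[xE yE]; [exists j, j.+1|exists j.+1, j];
  by split=> //; lia.
Qed.

(** With no bits dropped, a part of inner vertices stays in one path. One tick puts at most the two
    old levels [l] and [l.+1] on level [l], so neighbours have old levels from [l.-1] to [l.+2]. *)
Lemma clip_step x0 t : exists2 S : seq (nat * nat * nat), size S <= 4 &
  forall x y, code t.+1 zero zero x = code t.+1 zero zero x0 -> inner x y ->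
    code t zero zero x != code t zero zero y -> code t zero zero y \in S.
Proof.
case adr0: (adr x0) => [[j0 a0] b0]; pose l := level t.+1 a0 b0 j0.
exists [seq (i, a0 : nat, b0 : nat) | i <- [:: l.-1; l; l.+1; l.+2]] => // x y fx.
have := code_eq_root fx; rewrite /is_root => rE.
case/inner_edge => [a [b [i [j [ab i0 j0' ij [xE yE]]]]]] _.
move: rE fx; rewrite /code adr0 xE yE /=.
have -> : i == 0 = false by lia.
have -> : j == 0 = false by lia.
move=> <-; rewrite /zero !divn1 => -[lE /val_inj aE /val_inj bE]; subst a b.
have : level t a0 b0 j \in [:: l.-1; l; l.+1; l.+2].
  have [p [lp p1]] := level_split t 1 a0 b0.
  have neighbour : level t a0 b0 j = (level t a0 b0 i).+1 \/
      level t a0 b0 i = level t a0 b0 j \/ level t a0 b0 i = (level t a0 b0 j).+1.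
    by case: ij => ->; [case: (levelS t a0 b0 j)|case: (levelS t a0 b0 i)]; auto.
  have : l <= level t a0 b0 i <= l.+1.
    rewrite /l -lE -addn1 lp /=; move: p1 {lp}; case: p => [_|[_|//]].
      by rewrite plateau0 leqnn leqnSn.
    exact: plateau1_bounds.
  move: l (level t a0 b0 i) (level t a0 b0 j) neighbour => u v w.
  by rewrite !inE; lia.
by rewrite !inE => /or4P[] /eqP->; rewrite eqxx ?orbT.
Qed.

(** The position on the final cycle of length [M]; both ends of a path are at 0. *)
Definition fold x : nat := let: (j, a, b) := adr x in if j == 0 then 0 else level D a b j.

Lemma level0 a b : level D a b 0 = 0.
Proof. by apply/eqP; rewrite level_eq0. Qed.

Lemma level_last a b : E a b -> level D a b (m a b).+1 = M.
Proof. by move=> ab; rewrite levelD //; have := M_small ab; have := m_gt0 ab; lia. Qed.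

Lemma level_inner a b j : E a b -> 0 < j <= m a b -> 0 < level D a b j < M.
Proof. by move=> ab jm; rewrite levelD //; have := M_small ab; have := m_gt0 ab; lia. Qed.

Lemma M_gt1 a b : E a b -> 1 < M.
Proof. by move=> ab; have := M_small ab; have := m_gt0 ab; lia. Qed.

Lemma fold_path a b j x : E a b -> j <= (m a b).+1 -> adr x = path_adr a b j ->
  fold x = if level D a b j == M then 0 else level D a b j.
Proof.
move=> ab jm; have M1 := M_gt1 ab; rewrite /fold => ->; rewrite /path_adr.
case: (j =P 0) => [->|j0] /=; first by rewrite level0; case: ifP.
case: (j =P (m a b).+1) => [->|j1] /=; first by rewrite level_last ?eqxx.
have jm' : 0 < j <= m a b by lia.
rewrite (introF eqP j0); case/andP: (level_inner ab jm') => _; by case: ltngtP.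
Qed.

Lemma fold_edge x y : g x y ->
  [\/ fold x = (fold y).+1, fold y = (fold x).+1, fold x = fold y |
     (fold x = 0 /\ fold y = M.-1) \/ (fold y = 0 /\ fold x = M.-1)].
Proof.
case/adr_edge => a [b [j [ab jm xy]]].
wlog {xy} [xE yE] : x y / adr x = path_adr a b j /\ adr y = path_adr a b j.+1.
  move=> W; case: xy => /W; first by [].
  by case; [constructor 2|constructor 1|constructor 3|case; constructor 4; [right|left]].
rewrite (fold_path ab _ xE) 1?ltnW // (fold_path ab _ yE) //.
have jM : level D a b j < M.
  by rewrite levelD //; have := M_small ab; have := m_gt0 ab; lia.
have := M_gt1 ab; move: (levelS D a b j) jM; move: (level D a b j) => l [->|->] lM M1.
  by constructor 3.
rewrite (ltn_eqF lM); case: eqP => lM'; last by constructor 2.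
by constructor 4; right; split=> //; lia.
Qed.

(** The cycle is shrunk from the top: all positions from [q] on form one part. *)
Lemma fold_step x0 q : exists2 S : seq nat, size S <= 4 &
  forall x y, minn (fold x) q = minn (fold x0) q -> g x y ->
    minn (fold x) q.+1 != minn (fold y) q.+1 -> minn (fold y) q.+1 \in S.
Proof.
set z := minn _ q.
(* Besides consecutive positions, 0 and [M.-1] are adjacent across the closing of the cycle. *)
exists (if z == 0 then if q == 0 then [:: 0; 1] else [:: 0; 1; minn M.-1 q.+1]
        else [:: z.-1; z; z.+1; 0]); first by case: ifP => _ //; case: ifP.
move=> x y xE /fold_edge H _; move: H xE; move: z (fold x) (fold y) => z i j H xE.
case: (z =P 0) => [|z0]; [case: (q =P 0) => q0 z0|]; rewrite !inE; case: H => H; lia.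
Qed.

(* [b] is at once on level [M] of the paths ending in it and on level 0 of the
   paths starting from it. *)
Definition wrap l A B : nat * nat * nat := if l == M then (0, B, A) else (l, A, B).

Lemma code_path c s a b j x : E a b -> j <= (m a b).+1 -> adr x = path_adr a b j ->
  is_root x ==> (c 0 == s M) && (n <= 2 ^ c M) && (n <= 2 ^ s 0) ->
  let l := level D a b j in code D c s x = wrap l (a %/ 2 ^ c l) (b %/ 2 ^ s l).
Proof.
move=> ab jm; have M1 := M_gt1 ab; rewrite /code /is_root => ->; rewrite /path_adr /wrap.
case: (j =P 0) => [->|j0] /=.
  case/andP => [/andP[_ _] n0]; rewrite level0 (divn_exp2_small _ n0) //.
  by case: eqP => // M0; rewrite -M0 in M1.
case: (j =P (m a b).+1) => [->|j1] /=.
  case/andP => [/andP[/eqP-> nM] _]; rewrite level_last // eqxx.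
  by rewrite (divn_exp2_small _ nM).
have jm' : 0 < j <= m a b by lia.
by rewrite (introF eqP j0) => _; case/andP: (level_inner ab jm') => _; case: ltngtP.
Qed.

(** By truncated subtraction, bits of an end are first dropped far from that end. Halving makes a
    change of two in [sg - l] cost only one bit. *)
Definition shiftl sg l := (l + sg - M) %/ 2.
Definition shiftr sg l := (sg - l) %/ 2.

(** A branching vertex seen on level 0 and on level [M] must get the same prefix, and all bits of
    the opposite end must be gone. *)
Lemma shift_ends sg : M <= sg ->
  (shiftl sg 0 == shiftr sg M) && (n <= 2 ^ shiftl sg M) && (n <= 2 ^ shiftr sg 0).
Proof.
move=> Msg; rewrite /shiftl /shiftr; apply/andP; split; first (apply/andP; split).
- by apply/eqP; congr (_ %/ 2); lia.
- by apply: leq_trans n_small _; rewrite leq_exp2l // leq_div2r //; lia.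
- by apply: leq_trans n_small _; rewrite leq_exp2l // leq_div2r //; lia.
Qed.

(* A part at level [l] meets at most two parts at each adjacent level: one of
   the two shifts is not decreasing from [l] to that level, the other one
   decreases by at most one. *)
Lemma shift_step x0 sg (r : rel T) :
  (forall x y, r x y -> if M <= sg then g x y else inner x y) ->
  exists2 S : seq (nat * nat * nat), size S <= 4 &
  forall x y, code D (shiftl sg.+1) (shiftr sg.+1) x =
      code D (shiftl sg.+1) (shiftr sg.+1) x0 ->
    r x y ->
    code D (shiftl sg) (shiftr sg) x != code D (shiftl sg) (shiftr sg) y ->
    code D (shiftl sg) (shiftr sg) y \in S.
Proof.
move=> rP; set c := shiftl sg; set s := shiftr sg.
set c' := shiftl sg.+1; set s' := shiftr sg.+1.
(* The two candidate parts one level up; [i] is the unknown bit of [b]. In [dn] it is a bit of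
   [a]. *)
pose up l A B := [seq wrap l.+1 (A %/ 2 ^ (c l.+1 - c' l))
                      ((2 * B + i) %/ 2 ^ ((s l.+1).+1 - s' l)) | i <- [:: 0; 1]].
pose dn l A B := [seq wrap l.-1 ((2 * A + i) %/ 2 ^ ((c l.-1).+1 - c' l))
                      (B %/ 2 ^ (s l.-1 - s' l)) | i <- [:: 0; 1]].
have i01 i : i < 2 -> i \in [:: 0; 1] by case: i => [|[]].
have down2 A p q : p <= q -> A %/ 2 ^ q = (A %/ 2 ^ p) %/ 2 ^ (q - p).
  by move=> pq; rewrite -divnMA -expnD subnKC.
have upP l (a b : nat) : wrap l.+1 (a %/ 2 ^ c l.+1) (b %/ 2 ^ s l.+1) \in
    up l (a %/ 2 ^ c' l) (b %/ 2 ^ s' l).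
  have [|i i2 ->] := @divn_exp2_shift (s l.+1) (s' l) b; first by rewrite /s /s' /shiftr; lia.
  rewrite (down2 a (c' l) (c l.+1)); first by apply/mapP; exists i => //; apply: i01.
  by rewrite /c /c' /shiftl; lia.
have dnP l (a b : nat) : wrap l (a %/ 2 ^ c l) (b %/ 2 ^ s l) \in
    dn l.+1 (a %/ 2 ^ c' l.+1) (b %/ 2 ^ s' l.+1).
  have [|i i2 ->] := @divn_exp2_shift (c l) (c' l.+1) a; first by rewrite /c /c' /shiftl; lia.
  rewrite {1}(down2 b (s' l.+1) (s l)); first by apply/mapP; exists i; [apply: i01|].
  by rewrite /s /s' /shiftr; lia.
have [size_up size_dn] : (forall l A B, size (up l A B) = 2) /\
    (forall l A B, size (dn l A B) = 2).
  by [].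
clearbody up dn; case x0E: (code D c' s' x0) => [[l A] B].
(* Branching vertices are also on level [M] of their incoming paths, where [A] is the prefix of the
   second end. *)
exists (if l == 0 then up 0 A 0 ++ dn M 0 A else up l A B ++ dn l A B).
  by case: ifP; rewrite size_cat size_up size_dn.
move=> x y xE rxy.
have gxy : g x y by move/rP: rxy; case: ifP => // _ /and3P[].
(* Before time [M] the edge is inner and the implications are vacuous. *)
have endsP z : z = x \/ z = y ->
    is_root z ==> (c 0 == s M) && (n <= 2 ^ c M) && (n <= 2 ^ s 0) /\
    is_root z ==> (c' 0 == s' M) && (n <= 2 ^ c' M) && (n <= 2 ^ s' 0).
  move=> zE; move/rP: rxy; case: ifP => [Msg _|_ /and3P[_ rx ry]].
    by rewrite !shift_ends ?implybT // leqW.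
  by case: zE => ->; rewrite ?(negbTE rx) ?(negbTE ry).
have [ex ex'] := endsP x (or_introl erefl); have [ey _] := endsP y (or_intror erefl).
have [a [b [j [ab jm xy]]]] := adr_edge gxy.
have jM : level D a b j < M.
  by rewrite levelD //; have := M_small ab; have := m_gt0 ab; lia.
case: xy => -[adrx adry]; last rename adrx into adry, adry into adrx.
- have := code_path ab (leqW jm) adrx ex'; rewrite xE /= (code_path ab (leqW jm) adrx ex).
  rewrite (code_path ab _ adry ey) //=.
  have root0 : level D a b j = 0 -> b %/ 2 ^ s' (level D a b j) = 0.
    move=> l0; have j0 : j = 0 by move: l0; rewrite levelD //; lia.
    move: ex'; rewrite /is_root adrx j0 /= level0 => /andP[_].
    exact: divn_exp2_small.
  move: root0 (levelS D a b j) jM.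
  move: (level D a b j) => i root0 [->|->] iM; first by rewrite eqxx.
  rewrite [wrap i _ _ in X in X -> _]/wrap [wrap i _ _ in X in _ -> X -> _]/wrap.
  rewrite !(ltn_eqF iM) => -[-> -> ->] _.
  have := upP i a b; case: (i =P 0) root0 => [->|_] root0 upi; last by rewrite mem_cat upi.
  by rewrite root0 // in upi; rewrite mem_cat upi.
- have := code_path ab (jm : j.+1 <= _.+1) adrx ex'; rewrite xE /= => xE'.
  rewrite (code_path ab _ adrx ex) // (code_path ab (leqW jm) adry ey).
  have rootM : level D a b j.+1 = M -> a %/ 2 ^ c' (level D a b j.+1) = 0.
    move=> lM; have jE : j = m a b.
      by apply/eqP; apply: contra_eqT lM => jE; rewrite levelD //; have := M_small ab; lia.
    move: ex'; rewrite /is_root adrx /path_adr jE eqxx /= level_last // => /andP[/andP[_ +] _].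
    exact: divn_exp2_small.
  move: xE' rootM; case: (levelS D a b j) jM => ->;
    move: (level D a b j) => i iM; first by rewrite eqxx.
  rewrite [X in (_, _, _) = X]/wrap => + rootM _; case: eqP rootM => [iE|_] rootM.
    case=> -> -> _ /=; rewrite mem_cat; apply/orP; right.
    by rewrite -[X in dn _ X](rootM iE) -iE; apply: dnP.
  by case=> -> -> -> /=; rewrite mem_cat dnP orbT.
Qed.

Lemma shiftl_mono sg sg' l : sg <= sg' -> shiftl sg l <= shiftl sg' l.
Proof. by move=> ?; rewrite /shiftl leq_div2r //; lia. Qed.

Lemma shiftr_mono sg sg' l : sg <= sg' -> shiftr sg l <= shiftr sg' l.
Proof. by move=> ?; rewrite /shiftr leq_div2r //; lia. Qed.

Lemma code_root t c s x y : c 0 = 0 ->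
  is_root x -> code t c s x = code t c s y -> adr x = adr y.
Proof.
move=> c0 rx H; have := code_eq_root H; move: rx H; rewrite /code /is_root c0.
have := adr_valid x; have := adr_valid y.
case: (adr x) => -[i a] b; case: (adr y) => -[j a'] b' /=.
case: eqP => i0; case: eqP => j0 //= <- <- _.
by rewrite !divn1 i0 j0 => -[/val_inj ->].
Qed.

Lemma adr_inner a b j x : 0 < j <= m a b -> adr x = path_adr a b j -> adr x = (j, a, b).
Proof.
move=> jm ->; rewrite /path_adr; case: (j =P 0) => [|_]; first by lia.
by case: (j =P (m a b).+1) => // ?; lia.
Qed.

(* Before time [M] the branching vertices form singleton parts and their
   neighbours are merged only with each other, so edges at them stay black. *)
Lemma covers_inner : covers_red g inner (code D (shiftl M) (shiftr M)).
Proof.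
set c := shiftl M; set s := shiftr M.
have c0 : c 0 = 0 by rewrite /c /shiftl; lia.
have c1 : c 1 = 0 by rewrite /c /shiftl; lia.
have s1 : s M.-1 = 0 by rewrite /s /shiftr; lia.
have first_edge a b x y z w : E a b -> adr x = path_adr a b 0 -> adr y = path_adr a b 1 ->
    code D c s x = code D c s z -> code D c s y = code D c s w -> g z w && g w z.
  move=> ab xE yE; have m0 := m_gt0 ab.
  move/code_root => /(_ c0); rewrite /is_root xE => /(_ isT) zE yw.
  have := code_eq_root yw; have := adr_valid w.
  move: yw; rewrite /code /is_root (adr_inner _ yE) //.
  case wE: (adr w) => [[j a'] b'] /=; case: eqP => //= /eqP; rewrite -lt0n => j0.
  (* Only first inner vertices are on level 1, and no bit of [a] is dropped there, so [w] also
     follows [a] on a path. *)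
  have l1 : level D a b 1 = 1 by rewrite levelD //; have := M_small ab; lia.
  rewrite l1 => -[lj]; rewrite -lj c1 !divn1 => /val_inj aE _ [jm ab'] _; subst a'.
  have {}lj : j = 1 by move: lj; rewrite levelD //; have := M_small ab'; lia.
  apply: (edge_adr ab' (leq0n _)); first by rewrite -zE.
  rewrite wE lj /path_adr /=; case: eqP => // m1; have := m_gt0 ab'; lia.
have last_edge a b x y z w : E a b ->
    adr x = path_adr a b (m a b).+1 -> adr y = path_adr a b (m a b) ->
    code D c s x = code D c s z -> code D c s y = code D c s w -> g z w && g w z.
  move=> ab xE yE; have m0 := m_gt0 ab.
  have {}xE : adr x = (0, b, b) by rewrite xE /path_adr eqxx.
  move/code_root => /(_ c0); rewrite /is_root xE => /(_ isT) zE yw.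
  have := code_eq_root yw; have := adr_valid w.
  move: yw; rewrite /code /is_root (adr_inner _ yE) ?m0 ?leqnn //.
  case wE: (adr w) => [[j a'] b'] /=; rewrite (gtn_eqF m0); case: eqP => //= /eqP.
  rewrite -lt0n => j0.
  (* Likewise level [M.-1] holds only last inner vertices, with all bits of [b] kept. *)
  have l1 : level D a b (m a b) = M.-1 by rewrite levelD //; have := M_small ab; lia.
  rewrite l1 => -[lj] _; rewrite -lj s1 !divn1 => /val_inj bE [jm ab'] _; subst b'.
  have {}lj : j = m a' b by move: lj; rewrite levelD //; have := M_small ab'; lia.
  rewrite andbC; apply: (edge_adr ab' (leqnn _)).
    rewrite wE lj /path_adr; case: eqP => // mE; first by have := m_gt0 ab'; lia.
    by case: eqP => // mE'; lia.
  by rewrite -zE /path_adr eqxx.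
move=> x y z w xz yw gxy; rewrite /inner gxy /=.
have [//|rooted] := boolP (~~ is_root x && ~~ is_root y).
have [a [b [j [ab jm xy]]]] := adr_edge gxy.
have jj : j = 0 \/ j = m a b.
  move: rooted; rewrite negb_and !negbK /is_root.
  have : (path_adr a b j).1.1 = 0 \/ (path_adr a b j.+1).1.1 = 0 -> j = 0 \/ j = m a b.
    rewrite /path_adr eqSS; case: (j =P 0) => [->|j0] /=; first by left.
    case: (j =P m a b) => [->|j1] /=; first by right.
    by case: (j =P (m a b).+1) => //= j2; [lia|case].
  by case: xy => -[-> ->] H /orP[] /eqP ?; apply: H; auto.
apply/orP; right; case: xy => -[uE vE]; case: jj => jE; subst j.
- by have /andP[] := first_edge _ _ _ _ _ _ ab uE vE xz yw.
- by have /andP[] := last_edge _ _ _ _ _ _ ab vE uE yw xz.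
- by have /andP[] := first_edge _ _ _ _ _ _ ab uE vE yw xz.
- by have /andP[] := last_edge _ _ _ _ _ _ ab vE uE xz yw.
Qed.

Lemma code_zero x : code D (shiftl 0) (shiftr 0) x = code D zero zero x.
Proof.
have := adr_valid x; rewrite /code /zero; case: (adr x) => -[j a] b.
case: (j =P 0) => [_ _|j0 [jm ab]] /=; first by rewrite /shiftl sub0n div0n.
have jm' : 0 < j <= m a b by lia.
have lM := level_inner ab jm'.
rewrite (_ : shiftl 0 _ = 0); last by rewrite /shiftl; lia.
by rewrite (_ : shiftr 0 _ = 0); last by rewrite /shiftr; lia.
Qed.

Lemma solvable_fold q : solvable g 4 (fun x => minn (fold x) q).
Proof.
elim: q => [|q IH]; first by apply: solvable_const => // x y; rewrite !minn0.
apply: (@solvable_refine _ g _ g) IH => [x y|x y z w _ _ -> //|x0]; first by lia.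
exact: fold_step.
Qed.

Lemma fold_le x : fold x <= M.
Proof.
have := adr_valid x; rewrite /fold; case: (adr x) => -[j a] b; case: (j =P 0) => // j0 [jm ab].
by rewrite levelD //; have := M_small ab; lia.
Qed.

Lemma code_last x : code D (shiftl (M + M)) (shiftr (M + M)) x = (fold x, 0, 0).
Proof.
have := fold_le x; rewrite /code /fold; case: (adr x) => -[j a] b.
have small k u : u < n -> M %/ 2 <= k -> u %/ 2 ^ k = 0.
  by move=> un Mk; apply: (divn_exp2_small un); apply: leq_trans n_small _; rewrite leq_exp2l.
by case: eqP => _ lM; rewrite !small // ?/shiftl ?/shiftr leq_div2r //; lia.
Qed.

Lemma solvable_shift sg : sg <= M + M -> solvable g 4 (code D (shiftl sg) (shiftr sg)).
Proof.
(* Solvability passes from coarser to finer partitions, so the induction runs backwards in time. *)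
move=> sgM; rewrite -(subKn sgM); elim: (_ - sg) (leq_subr sg (M + M)) => [_|d IH dM].
  rewrite subn0. apply: (solvable_kernel _ (@solvable_fold M)) => x y.
  by rewrite !code_last !xpair_eqE !eqxx !andbT !(minn_idPl (fold_le _)).
have := IH (ltnW dM); set sg' := M + M - d.+1.
have -> : M + M - d = sg'.+1 by rewrite /sg'; lia.
case: (leqP M sg') => Msg.
  apply: (@solvable_refine _ g _ g) => [x y|x y z w _ _ -> //|x0].
    by apply: code_refine => l; [apply: shiftl_mono|apply: shiftr_mono].
  by apply: shift_step => x y; rewrite Msg.
apply: (@solvable_refine _ g _ inner) => [x y||x0].
- by apply: code_refine => l; [apply: shiftl_mono|apply: shiftr_mono].
- apply: covers_red_refine covers_inner => x y.
  by apply: code_refine => l; [apply: shiftl_mono|apply: shiftr_mono].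
- by apply: shift_step => x y; rewrite leqNgt Msg.
Qed.

Lemma solvable_clip t : t <= D -> solvable g 4 (code t zero zero).
Proof.
move=> tD; rewrite -(subKn tD); elim: (_ - t) (leq_subr t D) => [_|d IH dD].
  rewrite subn0; apply: (solvable_kernel _ (solvable_shift (leq0n _))) => x y.
  by rewrite !code_zero.
have := IH (ltnW dD); have -> : D - d = (D - d.+1).+1 by lia.
apply: (@solvable_refine _ g _ inner) => [x y||x0].
- exact: clip_refine.
- apply: covers_red_refine covers_inner => x y xy.
  apply: (@code_refine zero zero) => //; apply: clip_refine xy; lia.
- exact: clip_step.
Qed.

Lemma tww_le_4_of_adr : tww_le g 4.
Proof. exact: tww_le_solvable clip0_inj (solvable_clip (leq0n D)). Qed.

End Subdivision.

(** * Choice of the common length and construction of addresses *)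

Lemma leq_exp2_half n m : n ^ 2 <= 2 ^ m -> n <= 2 ^ (m.+1 %/ 2).
Proof.
move=> nm; rewrite -(leq_exp2r _ _ (ltn0Sn 1)); apply: leq_trans nm _.
by rewrite -expnM leq_exp2l //; lia.
Qed.

(* If [n <= 2] there is only one edge, otherwise every edge is subdivided at
   least four times. *)
Lemma common_length n (E : rel 'I_n) (m : 'I_n -> 'I_n -> nat) :
    (forall a b, E a b -> a < b) -> (forall a b, E a b -> n ^ 2 <= 2 ^ m a b) ->
  exists2 M, n <= 2 ^ (M %/ 2) &
    forall a b, E a b -> (m a b).+1 = M \/ 4 <= M <= (m a b).+1.
Proof.
move=> lt_E n_m; pose attained k := [exists a, exists b, E a b && (m a b == k)].
have attainedI a b : E a b -> attained (m a b).
  by move=> ab; apply/existsP; exists a; apply/existsP; exists b; rewrite ab eqxx.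
case: (boolP [exists a, exists b, E a b]) => [/existsP[a /existsP[b ab]]|noE]; last first.
  exists (n * 2); first by rewrite mulnK // ltnW // ltn_expl.
  by move=> a b ab; case/existsP: noE; exists a; apply/existsP; exists b.
have ex_k : exists k, attained k by exists (m a b); apply: attainedI.
have [k /existsP[a' /existsP[b' /andP[ab' /eqP mk]]] k_min] := ex_minnP ex_k.
have nk := n_m _ _ ab'; rewrite mk in nk.
(* A path with the minimal number [k] of inner vertices has [k.+1] edges. *)
exists k.+1; first exact: leq_exp2_half.
move=> u v uv; have := k_min _ (attainedI _ _ uv).
have [n2|n3] := leqP n 2.
  left; have := lt_E _ _ uv; have := lt_E _ _ ab'.
  have := ltn_ord a'; have := ltn_ord b'; have := ltn_ord u; have := ltn_ord v => *.
  have -> : u = a' by apply: val_inj => /=; lia.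
  have -> : v = b' by apply: val_inj => /=; lia.
  by rewrite mk.
move=> km; right; rewrite [X in _ && X]ltnS km andbT ltnS ltnNge; apply/negP => k2.
have : 2 ^ k <= 2 ^ 2 by rewrite leq_exp2l.
have : 3 ^ 2 <= n ^ 2 by rewrite leq_exp2r.
by move: nk; lia.
Qed.

Theorem theorem1p2 (n : nat) (e : rel 'I_n) (T : finType) (g : rel T) :
  simple_graph e ->
  (* each edge subdivided m times with m >= 2 log_2 n, i.e. n^2 <= 2^m *)
  is_subdivision e g (fun m => n ^ 2 <= 2 ^ m) ->
  tww_le g 4.
Proof.
move=> _ [phi [P [phi_inj P_ok T_cover gE]]].
(* Edges are oriented upwards, so that each vertex has only one address. *)
pose E : rel 'I_n := fun a b => (a < b) && e a b.
pose m a b := size (P a b).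
pose L a b := phi a :: P a b ++ [:: phi b].
have sizeL a b : size (L a b) = (m a b).+2 by rewrite /= size_cat addn1.
have n_m a b : E a b -> n ^ 2 <= 2 ^ m a b by case/andP => ab /(P_ok _ _ ab)[].
have m_gt0 a b : E a b -> 0 < m a b.
  move=> ab; have /andP[lt_ab _] := ab; have := n_m _ _ ab; case: (m a b) => // n1.
  have : 2 ^ 2 <= n ^ 2 by rewrite leq_exp2r //; have := ltn_ord b; lia.
  by move: n1; lia.
have [M n_M m_M] := common_length (fun a b (ab : E a b) => proj1 (andP ab)) n_m.
(* The default of [nth] is [x] itself, so the bound on [j] is essential: out of range the equality
   would hold trivially. *)
pose is_adr x (p : nat * 'I_n * 'I_n) := let: (j, a, b) := p in
  if j == 0 then (a == b) && (phi a == x)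
  else [&& E a b, j <= m a b & nth x (P a b) j.-1 == x].
have adr_ex x : exists p, is_adr x p.
  case: (T_cover x) => [[c ->]|[a [b [ab eab xP]]]].
    by exists (0, c, c); rewrite /is_adr !eqxx.
  exists ((index x (P a b)).+1, a, b).
  by rewrite /is_adr /= nth_index // eqxx /E ab eab /= andbT index_mem.
have in_P x j a b : is_adr x (j.+1, a, b) ->
    [/\ a < b, e a b, x \in P a b, j < size (P a b) & nth x (P a b) j = x].
  by case/and3P => /andP[ab eab] jm /eqP xE; split=> //; rewrite -xE mem_nth.
have adr_uniq x p q : is_adr x p -> is_adr x q -> p = q.
  case: p q => [[[|i] a] b] [[[|j] a'] b'].
  - by move=> /andP[/eqP<- /eqP<-] /andP[/eqP<- /eqP/phi_inj->].
  - move=> /andP[_ /eqP<-] /in_P[ab eab + _ _]; have [_ _ H] := P_ok _ _ ab eab.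
    by case/H => /(_ a); rewrite eqxx.
  - move=> /in_P[ab eab xP _ _] /andP[_ /eqP xE]; have [_ _ H] := P_ok _ _ ab eab.
    by have [/(_ a')] := H _ xP; rewrite xE eqxx.
  - move=> /in_P[ab eab xab im iE] /in_P[ab' eab' xab' jm jE].
    have [_ uP H] := P_ok _ _ ab eab.
    have [_ /(_ _ _ ab' eab' xab')[aE bE]] := H _ xab; subst a' b'.
    by congr (_.+1, _, _); apply/eqP; rewrite -(nth_uniq x im jm uP) iE jE.
pose adr x := xchoose (adr_ex x); have adrP x : is_adr x (adr x) := xchooseP (adr_ex x).
have adrE x p : (adr x = p) <-> is_adr x p.
  by split=> [<-//|xp]; apply: adr_uniq xp.
have pathE x a b j : E a b -> j <= (m a b).+1 ->
    adr x = path_adr m a b j <-> nth x (L a b) j = x.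
  move=> ab jm; rewrite adrE /path_adr /L; case: (j =P 0) => [->|j0].
    by rewrite /= eqxx; split=> /eqP.
  have -> : nth x (phi a :: P a b ++ [:: phi b]) j =
      if j == (m a b).+1 then phi b else nth x (P a b) j.-1.
    case: j j0 jm => // j _; rewrite ltnS => jm /=; rewrite nth_cat eqSS.
    by rewrite -/(m a b); case: (ltngtP j (m a b)) jm => // -> _; rewrite subnn.
  case: (j =P (m a b).+1) => [_|j1]; first by rewrite /= eqxx; split=> /eqP.
  rewrite /= (introF eqP j0) ab /=; have -> : j <= m a b by lia.
  by split=> /eqP.
apply: (@tww_le_4_of_adr n E T g m adr _ _ _ _ M m_gt0 m_M n_M
         (\max_(p : 'I_n * 'I_n) m p.1 p.2)).
- move=> x y xy; have := adrP x; have := adrP y; rewrite -xy.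
  case: (adr x) => -[[|j] a] b; first by move=> /andP[_ /eqP<-] /andP[_ /eqP<-].
  move=> /in_P[_ _ _ jm jy] /in_P[_ _ _ _ jx].
  by rewrite -jx -jy; apply: set_nth_default.
- by move=> x; have := adrP x; case: (adr x) => -[[|j] a] b /=; [case/andP => /eqP|case/and3P].
- move=> x y /gE[a [b [ab eab [s1 [s2 sE]]]]]; exists a, b, (size s1).
  have Eab : E a b by rewrite /E ab.
  have key u v : L a b = s1 ++ u :: v :: s2 -> size s1 <= m a b /\
      (adr u = path_adr m a b (size s1) /\ adr v = path_adr m a b (size s1).+1).
    move=> LE; have := sizeL a b; rewrite LE size_cat /= => szE.
    split; first by lia.
    by split; apply/pathE; rewrite ?LE ?nth_cat ?ltnn ?subnn ?ltnNge ?leqnSn ?subSnn //; lia.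
  by case: sE => /key[? ?]; split; auto.
- move=> a b j x y ab jm /(pathE _ _ _ _ ab (leqW jm)) xE /(pathE _ _ _ _ ab) => /(_ jm) yE.
  have LE : L a b = take j (L a b) ++ x :: y :: drop j.+2 (L a b).
    rewrite -{1}(cat_take_drop j (L a b)); congr (_ ++ _).
    have jL : j.+1 < size (L a b) by rewrite sizeL.
    by rewrite (drop_nth x (ltnW jL)) xE (drop_nth y jL) yE.
  have /andP[lt_ab eab] := ab.
  by apply/andP; split; apply/gE; exists a, b; split=> //;
    exists (take j (L a b)), (drop j.+2 (L a b)); auto.
- by move=> a b; apply: (leq_bigmax (F := fun p => m p.1 p.2) (a, b)).
Qed.
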